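(* Let $\mathbb{K}$ be a non-Archimedean valued field with valuation $|\cdot|$, and let $n$ be a positive integer. For every $A=[a_{j,k}]_{1\leq j\leq n,\,1\leq k\leq n}\in\mathbb{M}_n(\mathbb{K})$, $$\bigcup_{j,k=1,\ j\neq k}^n\{z\in\mathbb{K}: |z-a_{j,j}|\,|z-a_{k,k}|\leq h_j(A)h_k(A)\}\subseteq \bigcup_{j=1}^n\{z\in\mathbb{K}: |z-a_{j,j}|\leq h_j(A)\}$$ and $$\bigcup_{j,k=1,\ j\neq k}^n\{z\in\mathbb{K}: |z-a_{j,j}|\,|z-a_{k,k}|\leq v_j(A)v_k(A)\}\subseteq \bigcup_{j=1}^n\{z\in\mathbb{K}: |z-a_{j,j}|\leq v_j(A)\}.$$
   Context: A non-Archimedean valued field is a field $\mathbb{K}$ with a map $|\cdot|:\mathbb{K}\to[0,\infty)$ such that $|x|=0$ iff $x=0$, $|xy|=|x||y|$, and $|x+y|\leq\max\{|x|,|y|\}$ for all $x,y\in\mathbb{K}$. $\mathbb{M}_n(\mathbb{K})$ denotes the $n\times n$ matrices over $\mathbb{K}$. For $A=[a_{j,k}]\in\mathbb{M}_n(\mathbb{K})$, define $h_j(A)=\max_{1\leq k\leq n,\,k\neq j}|a_{j,k}|$ for $1\leq j\leq n$ and $v_k(A)=\max_{1\leq j\leq n,\,j\neq k}|a_{j,k}|$ for $1\leq k\leq n$, where a maximum over the empty set (occurring only when $n=1$) is $0$. *)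

(* Defs.v *)
From mathcomp Require Import all_boot all_order all_algebra.
From mathcomp Require Import classical_sets reals.

Set Implicit Arguments.
Unset Strict Implicit.
Unset Printing Implicit Defensive.

Import Order.TTheory GRing.Theory Num.Theory.

Local Open Scope classical_set_scope.
Local Open Scope ring_scope.

Record nonarch_valuation (R : realType) (K : fieldType) := NonarchValuation {
  nav_fun :> K -> R;
  nav_ge0 : forall x, 0 <= nav_fun x;
  nav_eq0 : forall x, nav_fun x = 0 <-> x = 0;
  nav_mul : forall x y, nav_fun (x * y) = nav_fun x * nav_fun y;
  nav_add_le : forall x y, nav_fun (x + y) <= Num.max (nav_fun x) (nav_fun y)
}.

(* Valuations are nonnegative, so starting the maxima below at 0 only matters
   when the index set is empty. *)
Definition row_offdiag_max (R : realType) (K : fieldType)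
    (v : nonarch_valuation R K) (n : nat) (A : 'M[K]_n) (j : 'I_n) : R :=
  \big[Num.max/0]_(k < n | k != j) v (A j k).

Definition col_offdiag_max (R : realType) (K : fieldType)
    (v : nonarch_valuation R K) (n : nat) (A : 'M[K]_n) (k : 'I_n) : R :=
  \big[Num.max/0]_(j < n | j != k) v (A j k).

(* Main.v *)
Require Import Defs.
From mathcomp Require Import all_boot all_order all_algebra.
From mathcomp Require Import classical_sets reals.

(** Each inclusion compares ovals of Cassini with discs centred at the diagonal
    entries.  If [z] lies outside both discs indexed by [j] and [k], its two
    distances strictly exceed the radii; these being nonnegative, the product
    of the distances strictly exceeds the product of the radii, so [z] lies
    outside the oval indexed by [(j, k)].  Rows and columns differ only in the
    family of radii, so both inclusions are instances of [ovals_sub_discs]. *)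

Set Implicit Arguments.
Unset Strict Implicit.
Unset Printing Implicit Defensive.

Import Order.TTheory GRing.Theory Num.Theory.

Local Open Scope classical_set_scope.
Local Open Scope ring_scope.

Lemma row_offdiag_max_ge0 (R : realType) (K : fieldType)
    (v : nonarch_valuation R K) (n : nat) (A : 'M[K]_n) (j : 'I_n) :
  0 <= row_offdiag_max v A j.
Proof. exact: bigmax_ge_id. Qed.

Lemma col_offdiag_max_ge0 (R : realType) (K : fieldType)
    (v : nonarch_valuation R K) (n : nat) (A : 'M[K]_n) (k : 'I_n) :
  0 <= col_offdiag_max v A k.
Proof. exact: bigmax_ge_id. Qed.

(** Contrapositive of the strict monotonicity of the product on nonnegative
    reals; the abstract distances [d] and radii [r] let it serve both rows and
    columns. *)
Lemma ovals_sub_discs (R : realType) (T I : Type) (P : set (I * I))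
    (d : T -> I -> R) (r : I -> R) (r_ge0 : forall i, 0 <= r i) :
  \bigcup_(p in P) [set z | d z p.1 * d z p.2 <= r p.1 * r p.2]
    `<=` \bigcup_(i in [set: I]) [set z | d z i <= r i].
Proof.
move=> z [[i j] _ /= oval_z].
have [zi|zi] := leP (d z i) (r i); first by exists i.
have [zj|zj] := leP (d z j) (r j); first by exists j.
by move: oval_z; rewrite leNgt ltr_pM.
Qed.

Theorem theorem2p6 (R : realType) (K : fieldType) (v : nonarch_valuation R K)
    (n : nat) (n_gt0 : (0 < n)%N) (A : 'M[K]_n) :
  \bigcup_(p in [set p : 'I_n * 'I_n | p.1 != p.2])
      [set z : K | v (z - A p.1 p.1) * v (z - A p.2 p.2)
                   <= row_offdiag_max v A p.1 * row_offdiag_max v A p.2]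
    `<=` \bigcup_(j in [set: 'I_n])
           [set z : K | v (z - A j j) <= row_offdiag_max v A j]
  /\
  \bigcup_(p in [set p : 'I_n * 'I_n | p.1 != p.2])
      [set z : K | v (z - A p.1 p.1) * v (z - A p.2 p.2)
                   <= col_offdiag_max v A p.1 * col_offdiag_max v A p.2]
    `<=` \bigcup_(j in [set: 'I_n])
           [set z : K | v (z - A j j) <= col_offdiag_max v A j].
Proof.
split.
- apply: (ovals_sub_discs (d := fun z j => v (z - A j j))) => j.
  exact: row_offdiag_max_ge0.
- apply: (ovals_sub_discs (d := fun z j => v (z - A j j))) => j.
  exact: col_offdiag_max_ge0.
Qed.
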